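(* Let $A$ be an integral ring. Then $A$ is a ring with divisors if and only if its divisorial Nagata ring $A_{\mathrm{div}}(\underline X)$ is a Prüfer domain, and also if and only if $A_{\mathrm{div}}(\underline X)$ is a Bézout domain.
   Context: Rings are commutative with unit. A ring is integral if every element is zero or regular; $A^*$ is the set of regular elements. $\underline X=(X_1,\dots,X_n)$ is a fixed nonempty finite list of indeterminates. Depth: a list $(a_1,\dots,a_n)$ has depth $\ge1$ if $a_1x=\dots=a_nx=0$ implies $x=0$. It has depth $\ge2$ if moreover every list $(x_1,\dots,x_n)$ with $a_ix_j=a_jx_i$ for all $i,j$ is of the form $x_j=xa_j$ (all $j$) for some $x$. This depends only on the ideal $\mathfrak a=\langle a_1,\dots,a_n\rangle$; one writes $\mathrm{Gr}(\mathfrak a)\ge2$. For $f\in A[\underline X]$, $\mathrm c(f)$ is the ideal of $A$ generated by the coefficients of $f$. The set $S_{\mathrm{div}}=\{f\in A[\underline X]: \mathrm{Gr}(\mathrm c(f))\ge2\}$ is a filter (saturated multiplicative set), and the divisorial Nagata ring is $A_{\mathrm{div}}(\underline X)=S_{\mathrm{div}}^{-1}A[\underline X]$, a subring of $(\mathrm{Frac}\,A)(\underline X)$. An element $g\in A^*$ is a strong gcd of $(a_1,\dots,a_n)$ in $A^*$ if for every $x\in A^*$, $xg$ is a gcd of $(xa_1,\dots,xa_n)$ in $A$. A list $(a_i)$ in $A^*$ is divisorially invertible if there is a list $(b_j)$ in $A^*$ such that $(a_ib_j)_{i,j}$ has a strong gcd. An integral ring is a ring with divisors (PvMD) if every nonempty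 finite list in $A^*$ (equivalently every nonzero finitely generated ideal) is divisorially invertible. *)

(* Defs.v *)
From HB Require Import structures.
From mathcomp Require Import all_boot all_order all_algebra.
From mathcomp Require Import boolp.
From mathcomp Require Import mpoly.

Set Implicit Arguments.
Unset Strict Implicit.
Unset Printing Implicit Defensive.

Import GRing.Theory.
Local Open Scope ring_scope.

Section CommutativeRings.
Variable R : comNzRingType.
Implicit Types (s a : seq R) (x y d : R) (I J : R -> Prop).

(* The set R^* of regular elements is [GRing.lreg], [R] being commutative. *)
Definition integral_ring : Prop := forall x, x = 0 \/ GRing.lreg x.

Definition divides d x : Prop := exists y, x = y * d.

(* Ideals are predicates; [gen_ideal s] is the ideal <s_0, ..., s_(k-1)>. *)
Definition is_ideal I : Prop :=
  [/\ I 0, forall x y, I x -> I y -> I (x + y) & forall x y, I y -> I (x * y)].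

Definition gen_ideal s : R -> Prop :=
  fun x => exists c : 'I_(size s) -> R, x = \sum_(i < size s) c i * s`_i.

Definition ideal_prod I J : R -> Prop :=
  fun x => exists k (u v : 'I_k -> R),
    [/\ forall i, I (u i), forall i, J (v i) & x = \sum_(i < k) u i * v i].

Definition invertible_ideal I : Prop :=
  exists J d, [/\ is_ideal J, GRing.lreg d &
    forall x, ideal_prod I J x <-> gen_ideal [:: d] x].

Definition prufer_domain : Prop :=
  integral_ring /\
  forall s, (exists2 x, gen_ideal s x & x <> 0) ->
    invertible_ideal (gen_ideal s).

Definition bezout_domain : Prop :=
  integral_ring /\
  forall s, exists d, forall x, gen_ideal s x <-> gen_ideal [:: d] x.

Definition depth_ge1 a : Prop :=
  forall x, (forall i : 'I_(size a), a`_i * x = 0) -> x = 0.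

Definition depth_ge2 a : Prop :=
  depth_ge1 a /\
  forall x : 'I_(size a) -> R,
    (forall i j : 'I_(size a), a`_i * x j = a`_j * x i) ->
    exists y, forall j, x j = y * a`_j.

(* Gr(I) >= 2, for a finitely generated ideal [I]: the depth of a list depends
   only on the ideal that the list generates. *)
Definition Gr_ge2 I : Prop :=
  exists a, (forall x, I x <-> gen_ideal a x) /\ depth_ge2 a.

Definition is_gcd s g : Prop :=
  (forall x, x \in s -> divides g x) /\
  (forall d, (forall x, x \in s -> divides d x) -> divides d g).

Definition strong_gcd s g : Prop :=
  GRing.lreg g /\
  forall x, GRing.lreg x -> is_gcd [seq x * y | y <- s] (x * g).

Definition div_invertible s : Prop :=
  exists t : seq R, (forall y, y \in t -> GRing.lreg y) /\
    exists g, strong_gcd [seq x * y | x <- s, y <- t] g.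

Definition ring_with_divisors : Prop :=
  integral_ring /\
  forall s, s <> [::] -> (forall x, x \in s -> GRing.lreg x) ->
    div_invertible s.

Definition content n (f : {mpoly R[n]}) : R -> Prop :=
  gen_ideal [seq f@_m | m <- msupp f].

Definition S_div n (f : {mpoly R[n]}) : Prop := Gr_ge2 (content f).

Lemma mem_gen_ideal s x : x \in s -> gen_ideal s x.
Proof.
move=> xs; have lt : (index x s < size s)%N by rewrite index_mem.
exists (fun i => (i == Ordinal lt)%:R).
rewrite (bigD1 (Ordinal lt)) //= eqxx mul1r nth_index // big1 ?addr0 //.
by move=> i /negbTE ->; rewrite mul0r.
Qed.

Lemma gen_ideal_sub s I : is_ideal I -> (forall x, x \in s -> I x) ->
  forall x, gen_ideal s x -> I x.
Proof.
case=> I0 ID IM sI x [c ->]; elim/big_rec: _ => // i y _ Iy.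
by apply: ID => //; apply: IM; apply: sI; rewrite mem_nth.
Qed.

(* Proof device for [S_divM]: the closure of [I] under
   "b k * x is in the closure for all k, hence x is in the closure". *)
Inductive saturation (K : Type) (b : K -> R) I : R -> Prop :=
| Sat_base x of I x : saturation b I x
| Sat_step x of (forall k, saturation b I (b k * x)) : saturation b I x.

Lemma saturation_ideal (K : Type) (b : K -> R) I :
  is_ideal I -> is_ideal (saturation b I).
Proof.
case=> I0 ID IM.
have satM x y : saturation b I y -> saturation b I (x * y).
  elim=> {}y => [Iy|_ IH]; first exact/Sat_base/IM.
  by apply: Sat_step => k; rewrite mulrCA; apply: IH.
split=> //; first exact: Sat_base.
move=> x y sx; elim: sx y => {}x.
  move=> Ix y sy; elim: sy x Ix => {}y => [Iy x Ix|_ IH x Ix].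
    exact/Sat_base/ID.
  by apply: Sat_step => k; rewrite mulrDr; apply: IH => //; apply: IM.
move=> _ IH y sy; apply: Sat_step => k; rewrite mulrDr; apply: IH => //.
exact: satM.
Qed.

Section IdealPolynomials.
Variables (n : nat) (V : R -> Prop).
Hypothesis idV : is_ideal V.
Implicit Types f g u : {mpoly R[n]}.

Lemma mcoeff_idealB f g : (forall m, V f@_m) -> (forall m, V g@_m) ->
  forall m, V (f - g)@_m.
Proof.
case: idV => _ VD VM Vf Vg m; rewrite mcoeffB; apply: VD => //.
by rewrite -mulN1r; apply: VM.
Qed.

Lemma mcoeff_idealZ c f : (forall m, V f@_m) -> forall m, V (c *: f)@_m.
Proof. by case: idV => _ _ VM Vf m; rewrite mcoeffZ; apply: VM. Qed.

Lemma mcoeff_idealM f g : (forall m, V g@_m) -> forall m, V (f * g)@_m.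
Proof.
case: idV => V0 VD VM Vg m; rewrite mcoeffM.
by elim/big_rec: _ => // i x _ Vx; apply: VD => //; apply: VM.
Qed.

Lemma mlead_rem g : g != 0 ->
  (size (msupp (g - mleadc g *: 'X_[mlead g]))).+1 = size (msupp g).
Proof.
move=> nz; rewrite (perm_size (msupp_rem _ _)) size_rem ?mlead_supp // prednK //.
by rewrite lt0n size_eq0 msupp_eq0.
Qed.

Lemma mleadX_ideal k g u : (size (msupp u) <= k)%N ->
  (forall m, V (u * g)@_m) -> forall m, V (mleadc g ^+ k *: u)@_m.
Proof.
case: (idV) => V0 VD VM.
elim: k u => [|k IH] u szu Vug m.
  have -> : u = 0.
    by apply/eqP; rewrite -msupp_eq0 -size_eq0 -leqn0.
  by rewrite scaler0 mcoeff0.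
have [->|nzu] := eqVneq u 0; first by rewrite scaler0 mcoeff0.
set c := mleadc g; set t := mleadc u *: 'X_[mlead u]; pose u1 := u - t.
have Vct i : V (c *: t)@_i.
  rewrite /t scalerA mcoeffZ mulrC; apply: VM.
  by rewrite mulrC -mleadcM; apply: Vug.
have szu1 : (size (msupp (c *: u1)) <= k)%N.
  apply: (@leq_trans (size (msupp u1))).
    by apply: uniq_leq_size (msupp_uniq _) _; apply: msuppZ_le.
  by rewrite -ltnS /u1 /t mlead_rem.
have Vu1g i : V (c *: u1 * g)@_i.
  rewrite /u1 scalerBr mulrBl; apply: mcoeff_idealB.
    by move=> j; rewrite -scalerAl; apply: mcoeff_idealZ.
  by move=> j; rewrite mulrC; apply: mcoeff_idealM.
have -> : c ^+ k.+1 *: u = c ^+ k *: (c *: u1) + c ^+ k *: (c *: t).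
  by rewrite -scalerDr -scalerDr /u1 subrK scalerA exprSr.
by rewrite mcoeffD; apply: VD; [apply: IH | apply: mcoeff_idealZ].
Qed.

End IdealPolynomials.

Lemma mcoeff_saturated n (V : R -> Prop) (g u : {mpoly R[n]}) :
  is_ideal V -> (forall x, (forall m, V (g@_m * x)) -> V x) ->
  (forall m, V (u * g)@_m) -> forall m, V u@_m.
Proof.
elim: {g}(size (msupp g)) {-2}g (leqnn (size (msupp g))) V u.
  move=> g; rewrite leqn0 size_eq0 msupp_eq0 => /eqP -> V u [V0 _ _] sV _ m.
  by apply: sV => k; rewrite mcoeff0 mul0r.
move=> k IH g szg V u idV sV Vug.
have [V0 VD VM] := idV.
have [g0|nzg] := eqVneq g 0.
  by move=> m; apply: sV => i; rewrite g0 mcoeff0 mul0r.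
set c := mleadc g; pose g' := g - c *: 'X_[mlead g].
have szg' : (size (msupp g') <= k)%N by rewrite -ltnS /g' mlead_rem.
have coefg' m : m != mlead g -> g'@_m = g@_m.
  by move=> ne; rewrite mcoeffB mcoeffZ mcoeffX eq_sym (negbTE ne) mulr0 subr0.
have down w : (forall m, V (c *: w)@_m) -> (forall m, V (w * g)@_m) ->
    forall m, V w@_m.
  move=> Vcw Vwg m.
  have : saturation (fun i => g'@_i) V w@_m.
    apply: (IH g') => //; first exact: saturation_ideal.
      by move=> x sx; apply: Sat_step.
    move=> {}m; apply: Sat_base; rewrite /g' mulrBr; apply: mcoeff_idealB => //.
    by move=> i; rewrite -scalerAr scalerAl mulrC; apply: mcoeff_idealM.
  have : V (c * w@_m) by rewrite -mcoeffZ.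
  move: (w@_m) => z Vcz sz; elim: sz Vcz => // {}z _ IHz Vcz.
  apply: sV => i; have [->//|ne] := eqVneq i (mlead g).
  by rewrite -coefg' //; apply: IHz; rewrite mulrCA; apply: VM.
have VN N : (forall m, V (c ^+ N *: u)@_m) -> forall m, V u@_m.
  elim: N => [|N IHN]; first by rewrite expr0 scale1r.
  move=> VcN; apply: IHN; apply: down; first by rewrite scalerA -exprS.
  by move=> m; rewrite -scalerAl; apply: mcoeff_idealZ.
exact: VN (mleadX_ideal idV (leqnn _) Vug).
Qed.

End CommutativeRings.

Section DivisorialNagata.
Variables (A : idomainType) (n : nat).
Implicit Types f g : {mpoly A[n]}.

Lemma S_div_neq0 f : S_div f -> f != 0.
Proof.
case=> a [aE [a1 _]]; apply/eqP => f0.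
suff : (1 : A) = 0 by apply/eqP/oner_neq0.
apply: a1 => i; rewrite mulr1.
have : content f a`_i by apply/aE/mem_gen_ideal/mem_nth.
apply: (gen_ideal_sub (I := fun x => x = 0)) => [|_ /mapP[m _ ->]].
  split=> // [x y -> ->|x _ ->]; first exact: addr0.
  exact: mulr0.
by rewrite f0 mcoeff0.
Qed.

Lemma S_div1 : S_div (1 : {mpoly A[n]}).
Proof.
exists [seq (1 : {mpoly A[n]})@_m | m <- msupp (1 : {mpoly A[n]})].
split=> //; rewrite msupp1 /= mcoeff1 eqxx; split.
  by move=> x /(_ ord0); rewrite mul1r.
by move=> x _; exists (x ord0) => j; rewrite ord1 mulr1.
Qed.

Lemma S_div_saturated f (h x0 : A) : h != 0 -> S_div f ->
  forall x, (forall m, divides h (x0 * (f@_m * x))) -> divides h (x0 * x).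
Proof.
move=> nzh [a [aE [a1 a2]]] x Vx.
have ax (i : 'I_(size a)) : divides h (x0 * (a`_i * x)).
  pose J r := divides h (x0 * (r * x)).
  have idJ : is_ideal J.
    split; first by exists 0; rewrite !mul0r mulr0.
      by move=> r s [y ry] [z sz]; exists (y + z); rewrite !mulrDl mulrDr ry sz.
    by move=> r s [z sz]; exists (r * z); rewrite -mulrA -sz -mulrA mulrCA.
  suff : content f a`_i.
    by apply: (gen_ideal_sub (I := J)) => // _ /mapP[m _ ->]; apply: Vx.
  exact/aE/mem_gen_ideal/mem_nth.
have [y yE] := fin_all_exists ax.
have [i j|z zE] := a2 y.
  apply: (mulIf nzh); rewrite -!mulrA -!yE; rewrite !mulrA.
  by rewrite [a`_i * x0]mulrC [a`_j * x0]mulrC -!mulrA; congr (_ * _); rewrite mulrCA.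
exists z; apply/eqP; rewrite -subr_eq0; apply/eqP/a1 => i.
by rewrite mulrBr mulrCA yE zE [z * _]mulrC mulrA subrr.
Qed.

Lemma S_divM f g : S_div f -> S_div g -> S_div (f * g).
Proof.
move=> Sf Sg; set s := [seq (f * g)@_m | m <- msupp (f * g)].
exists s; split=> //.
have nz : f * g != 0 by rewrite mulf_neq0 ?S_div_neq0.
have hs : mleadc (f * g) \in s by apply: map_f; apply: mlead_supp.
have lt : (index (mleadc (f * g)) s < size s)%N by rewrite index_mem.
pose i0 := Ordinal lt; pose h := s`_i0.
have nzh : h != 0 by rewrite /h /= nth_index // mleadc_eq0.
split=> [x /(_ i0) /eqP|x xE].
  by rewrite mulf_eq0 (negbTE nzh) => /eqP.
pose V w := divides h (x i0 * w).
have idV : is_ideal V.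
  split; first by exists 0; rewrite mulr0 mul0r.
    by move=> r t [y ry] [z tz]; exists (y + z); rewrite mulrDr ry tz mulrDl.
  by move=> r t [z tz]; exists (r * z); rewrite mulrCA tz mulrA.
have Vh m : V (f * g)@_m.
  have [ms|nms] := boolP (m \in msupp (f * g)); last first.
    by rewrite (memN_msupp_eq0 nms); case: idV.
  have : (f * g)@_m \in s by apply: map_f.
  move=> /(nthP 0) [j ltj <-]; exists (x (Ordinal ltj)).
  by rewrite [RHS]mulrC /h (xE i0 (Ordinal ltj)) mulrC.
have Vf : forall m, V f@_m.
  by apply: (mcoeff_saturated idV _ Vh); apply: S_div_saturated.
have [y] : V 1.
  by apply: (S_div_saturated nzh Sf) => m; rewrite mulr1; apply: Vf.
rewrite mulr1 => yE; exists y => j; apply: (mulfI nzh).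
by rewrite (xE i0 j) yE mulrA mulrC [s`_j * y]mulrC.
Qed.

(* S_div^-1 A[X], as a subring of Frac(A[X]) = (Frac A)(X). *)
Definition div_nagata_pred : {pred {fraction {mpoly A[n]}}} :=
  fun x => `[< exists f g, S_div g /\ x = tofrac f / tofrac g >].

Lemma div_nagata_subring : subring_closed div_nagata_pred.
Proof.
split.
- apply/asboolP; exists 1, 1; split; first exact: S_div1.
  by rewrite divr1.
- move=> _ _ /asboolP[f [s [Ss ->]]] /asboolP[g [t [St ->]]]; apply/asboolP.
  exists (f * t - g * s), (s * t); split; first exact: S_divM.
  have nzs : tofrac s != 0 by rewrite tofrac_eq0 S_div_neq0.
  have nzt : tofrac t != 0 by rewrite tofrac_eq0 S_div_neq0.
  by rewrite -mulNr addf_div // mulNr rmorphB !rmorphM.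
- move=> _ _ /asboolP[f [s [Ss ->]]] /asboolP[g [t [St ->]]]; apply/asboolP.
  exists (f * g), (s * t); split; first exact: S_divM.
  by rewrite !rmorphM /= mulf_div.
Qed.

HB.instance Definition _ :=
  GRing.isSubringClosed.Build _ div_nagata_pred div_nagata_subring.

Record div_nagata : predArgType :=
  DivNagata { div_nagata_val : {fraction {mpoly A[n]}};
              _ : div_nagata_val \in div_nagata_pred }.

HB.instance Definition _ := [isSub for div_nagata_val].
HB.instance Definition _ := [Choice of div_nagata by <:].
HB.instance Definition _ := [SubChoice_isSubComNzRing of div_nagata by <:].

End DivisorialNagata.

(* Main.v *)
Require Import Defs.
From mathcomp Require Import all_boot all_algebra.
From mathcomp Require Import boolp mpoly.

Set Implicit Arguments.
Unset Strict Implicit.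
Unset Printing Implicit Defensive.

Import GRing.Theory.
Local Open Scope ring_scope.

(* If A is a ring with divisors and f, f' are polynomials, then for N large the
   polynomial F = f + X_1^N f' has as coefficients exactly those of f and f'.
   Choose a list t such that the products of the coefficients of F with t have a
   strong gcd g, and spread t over a polynomial h with such gaps that the
   coefficients of F h are exactly these products.  Then p = F h / g is in S_div,
   f h / g is a polynomial, and f = F (f h / g) / p; likewise for f'.  So every
   two-generated ideal of the Nagata ring is principal.

   Conversely, if (s_i) generates an invertible ideal of the Nagata ring, there
   is a matrix e of trace 1 with s_k e_ij = s_i e_kj.  A common denominator
   writes e_ij = E_ij / u with u in S_div.  The coefficients of the row E_0j,
   multiplied by the s_i, are s_0 times those of all the E_ij; since the trace
   of E is u, they have s_0 as strong gcd. *)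

(** * Principal and invertible ideals *)

Section Ideals.
Variable R : comNzRingType.
Implicit Types (s : seq R) (x y d : R) (I J : R -> Prop).

Lemma gen_ideal_is_ideal s : is_ideal (gen_ideal s).
Proof.
split=> [|x y [a ->] [b ->]|x y [a ->]].
- by exists (fun=> 0); rewrite big1 // => i _; rewrite mul0r.
- exists (fun i => a i + b i); rewrite -big_split /=.
  by apply: eq_bigr => i _; rewrite mulrDl.
- exists (fun i => x * a i); rewrite mulr_sumr.
  by apply: eq_bigr => i _; rewrite mulrA.
Qed.

Lemma divides_is_ideal d : is_ideal (divides d).
Proof.
split=> [|x y [a ->] [b ->]|x y [a ->]]; first by exists 0; rewrite mul0r.
  by exists (a + b); rewrite mulrDl.
by exists (x * a); rewrite mulrA.
Qed.

Lemma gen_ideal1P d x : gen_ideal [:: d] x <-> divides d x.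
Proof.
split.
  apply: gen_ideal_sub; first exact: divides_is_ideal.
  by move=> y /[!inE] /eqP ->; exists 1; rewrite mul1r.
by case=> y ->; exists (fun=> y); rewrite big_ord1.
Qed.

Lemma is_ideal_sum I k (F : 'I_k -> R) :
  is_ideal I -> (forall i, I (F i)) -> I (\sum_(i < k) F i).
Proof. by case=> I0 ID _ IF; elim/big_rec: _ => // i x _; apply: ID. Qed.

(** Because [x + z * y] already lies in the ideal of [x] and [y], it generates that ideal once it
    divides both. Induction on the list then merges its head with a generator of the tail. *)
Lemma bezout_domain_of_pair : integral_ring R ->
  (forall x y, exists z, divides (x + z * y) x /\ divides (x + z * y) y) ->
  bezout_domain R.
Proof.
move=> intR pairR; split=> // s.
suff [d [sd ds]] : exists d, gen_ideal s d /\ forall x, x \in s -> divides d x.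
  exists d => x; split.
    apply: gen_ideal_sub; first exact: gen_ideal_is_ideal.
    by move=> y /ds /gen_ideal1P.
  case: (gen_ideal_is_ideal s) => _ _ sM /gen_ideal1P[y ->]; exact: sM.
elim: s => [|x s [d [sd ds]]].
  by exists 0; split=> //; case: (gen_ideal_is_ideal (Nil R)).
have [z [dx dy]] := pairR x d; exists (x + z * d).
case: (gen_ideal_is_ideal (x :: s)) => _ xsD xsM; split.
  apply: xsD; first by apply: mem_gen_ideal; rewrite mem_head.
  apply: xsM; move: sd; apply: gen_ideal_sub => [|y ys].
    exact: gen_ideal_is_ideal.
  by apply: mem_gen_ideal; rewrite inE ys orbT.
move=> y /[!inE] /predU1P[->//|/ds[w ->]].
by case: (divides_is_ideal (x + z * d)) => _ _; apply.
Qed.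

Lemma bezout_prufer : bezout_domain R -> prufer_domain R.
Proof.
case=> intR bezR; split=> // s [x sx nzx]; have [d sE] := bezR s.
(* The whole ring serves as inverse, since the product need only be generated by a regular
   element. *)
exists (fun=> True), d; split=> //.
  case: (intR d) => // d0; case: nzx.
  by have /gen_ideal1P[y ->] := (sE x).1 sx; rewrite d0 mulr0.
move=> y; split.
  case=> k [u [v [su _ ->]]]; apply: is_ideal_sum (gen_ideal_is_ideal _) _ => i.
  rewrite mulrC; case: (gen_ideal_is_ideal [:: d]) => _ _; apply.
  exact/sE.
move=> /sE sy; exists 1%N, (fun=> y), (fun=> 1); split=> //.
by rewrite big_ord1 mulr1.
Qed.

(** Write [d] as the sum of the [s_i * q_i] with [q_i] in [J]. Each [s_i * q_j] lies in the product
    ideal, so it is [e_ij * d]; cancelling [d] gives the trace and the proportionality of rows. *)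
Lemma invertible_localization_matrix s : invertible_ideal (gen_ideal s) ->
  exists e : 'I_(size s) -> 'I_(size s) -> R, \sum_i e i i = 1 /\
    forall i j k : 'I_(size s), s`_k * e i j = s`_i * e k j.
Proof.
case=> J [d [[J0 JD JM] reg_d IJ]].
have [l [u [v [su Jv dE]]]] : ideal_prod (gen_ideal s) J d.
  by apply/IJ/mem_gen_ideal; rewrite mem_head.
have [c cE] := fin_all_exists su.
pose q i := \sum_j c j i * v j.
have Jq i : J (q i) by apply: is_ideal_sum => // j; apply: JM.
have dq (ij : 'I_(size s) * 'I_(size s)) : divides d (s`_ij.1 * q ij.2).
  apply/gen_ideal1P/IJ; exists 1%N, (fun=> s`_ij.1), (fun=> q ij.2).
  by split=> //; rewrite ?big_ord1 // => _; apply/mem_gen_ideal/mem_nth.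
have [e eE] := fin_all_exists dq; exists (fun i j => e (i, j)); split.
  apply: reg_d; rewrite mulr1 [RHS]dE mulrC mulr_suml.
  under [RHS]eq_bigr => j _ do rewrite cE mulr_suml.
  rewrite exchange_big; apply: eq_bigr => i _.
  rewrite -(eE (i, i)) mulr_sumr; apply: eq_bigr => j _ /=.
  by rewrite mulrA [s`_i * _]mulrC.
move=> i j k; apply: reg_d; rewrite ![d * _]mulrC -!mulrA.
by rewrite -(eE (i, j)) -(eE (k, j)) mulrCA.
Qed.

End Ideals.

(** * Polynomials with prescribed coefficients *)

Section Polynomials.
Variables (R : comNzRingType) (n : nat).
Implicit Types f g h : {mpoly R[n]}.

(* Shifting [g] past the degree of [f] makes the supports disjoint. *)
Lemma mpoly_merge f g : (0 < n)%N -> exists w,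
  (forall m, exists m', (f + 'X_[w] * g)@_m' = f@_m) /\
  (forall m, exists m', (f + 'X_[w] * g)@_m' = g@_m).
Proof.
move=> n_gt0; pose N := msize f.
pose w : 'X_{1..n} := (U_(Ordinal n_gt0) *+ N)%MM; exists w.
have dw : mdeg w = N by rewrite mdegMn mdeg1 mul1n.
have gE m : (f + 'X_[w] * g)@_(w + m) = g@_m.
  rewrite mcoeffD mulrC mcoeffMX memN_msupp_eq0 ?add0r //.
  by apply: msize_mdeg_ge; rewrite mdegD dw leq_addr.
split=> m; last by exists (w + m)%MM.
have [fm|nfm] := boolP (m \in msupp f); last first.
  (* The value 0 must occur too: this monomial has degree too large for [f] and for the shifted
     [g]. *)
  exists (w + w + U_(Ordinal n_gt0) *+ msize g)%MM.
  rewrite -addmA gE (memN_msupp_eq0 nfm) memN_msupp_eq0 //.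
  by apply: msize_mdeg_ge; rewrite mdegD mdegMn mdeg1 mul1n leq_addl.
exists m; rewrite mcoeffD [X in _ + X]memN_msupp_eq0 ?addr0 //.
rewrite mulrC (perm_mem (msuppMX _ _)); apply/mapP => -[m' _ mE].
by have := msize_mdeg_lt fm; rewrite mE mdegD dw ltnNge leq_addr.
Qed.

Lemma mpoly_divides (a : R) f :
  (forall m, divides a f@_m) -> exists p, f = a *: p.
Proof.
elim: {f}(size (msupp f)) {-2}f (leqnn (size (msupp f))) => [|k IH] f.
  rewrite leqn0 size_eq0 msupp_eq0 => /eqP -> _.
  by exists 0; rewrite scaler0.
move=> szf af; have [->|nzf] := eqVneq f 0; first by exists 0; rewrite scaler0.
have [c cE] := af (mlead f).
have [||p pE] := IH (f - mleadc f *: 'X_[mlead f]).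
- by rewrite -ltnS mlead_rem.
- apply: (mcoeff_idealB (divides_is_ideal a)) => // m.
  rewrite mcoeffZ mulrC; case: (divides_is_ideal a) => _ _; apply.
  exact: af.
exists (p + c *: 'X_[mlead f]); rewrite scalerDr -pE scalerA [a * c]mulrC -cE.
by rewrite subrK.
Qed.

(** Take [h = x + X^w h'], with [h'] built for the tail and [w] large enough that [x f] and
    [X^w f h'] do not overlap. The second clause bounds the coefficients of products by [h], so that
    they are divisible by the gcd. *)
Lemma mpoly_with_products f (t : seq R) : (0 < n)%N -> exists h,
  (forall y m, y \in t -> exists m', (f * h)@_m' = f@_m * y) /\
  (forall m, gen_ideal t h@_m).
Proof.
move=> n_gt0; elim: t => [|x t [h [fh th]]].
  exists 0; split=> // m; rewrite mcoeff0.
  by case: (gen_ideal_is_ideal (Nil R)).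
have [w [wl wr]] := mpoly_merge (x *: f) (f * h) n_gt0.
have idxt := gen_ideal_is_ideal (x :: t); case: (idxt) => _ xtD xtM.
have xx : gen_ideal (x :: t) x by apply: mem_gen_ideal; rewrite mem_head.
exists (x%:MP + 'X_[w] * h).
have -> : f * (x%:MP + 'X_[w] * h) = x *: f + 'X_[w] * (f * h).
  by rewrite mulrDr mulrCA [f * _]mulrC mul_mpolyC.
split=> [y m /[!inE] /predU1P[->|yt]|m].
- by have [m' mE] := wl m; exists m'; rewrite mE mcoeffZ mulrC.
- by have [m1 <-] := fh y m yt; apply: wr.
- rewrite mcoeffD mcoeffC; apply: xtD; first by rewrite mulrC; apply: xtM.
  apply: mcoeff_idealM => // {}m; move: (th m); apply: gen_ideal_sub => [//|y yt].
  by apply: mem_gen_ideal; rewrite inE yt orbT.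
Qed.

End Polynomials.

(** * Strong gcds and the divisorial Nagata ring *)

Section Nagata.
Variables (A : idomainType) (n : nat).
Implicit Types f g h p : {mpoly A[n]}.
Local Notation B := (div_nagata A n).

Lemma idomain_integral : integral_ring A.
Proof. by move=> x; have [->|/lregP] := eqVneq x 0; [left | right]. Qed.

Lemma strong_gcd_neq0 (s : seq A) (g : A) : strong_gcd s g ->
  exists2 y, y \in s & y != 0.
Proof.
case=> /lregP nzg /(_ 1 (@lreg1 A)) [_ gcdg].
case: (boolP (has (fun y => y != 0) s)) => [/hasP//|/hasPn s0].
(* If all entries vanished, 0 would be a common divisor and hence divide [g]. *)
case: (gcdg 0) => [_ /mapP[y /s0 /negPn/eqP -> ->]|y].
  by exists 0; rewrite !mulr0.
by rewrite mul1r mulr0 => /eqP; rewrite (negbTE nzg).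
Qed.

(** Let [x] be proportional to the coefficients [c] of [p]. From [x_0 c_j g = c_0 x_j g], the
    element [c_0 g] divides every [x_0 y] with [y] in [s], hence also [x_0 g]. The quotient of [x_0]
    by [c_0] is the required factor. *)
Lemma S_div_strong_gcd (s : seq A) (g : A) p : strong_gcd s g ->
  (forall y, y \in s -> exists m, y = p@_m * g) -> S_div p.
Proof.
move=> sgcd sp; have [/lregP nzg gcdg] := sgcd.
pose c := [seq p@_m | m <- msupp p]; exists c; split=> //.
have cP m : p@_m != 0 -> exists i : 'I_(size c), c`_i = p@_m.
  rewrite -mcoeff_msupp => /(map_f (fun m => p@_m)) /(nthP 0) [i lt_i ci].
  by exists (Ordinal lt_i).
have [i0 nz0] : exists i : 'I_(size c), c`_i != 0.
  have [y ys] := strong_gcd_neq0 sgcd; have [m ->] := sp y ys.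
  rewrite mulf_eq0 => /norP[nzm _]; have [i ci] := cP m nzm.
  by exists i; rewrite ci.
split=> [x /(_ i0) /eqP|x xE].
  by rewrite mulf_eq0 (negbTE nz0) => /eqP.
have [x0|nzx] := eqVneq (x i0) 0.
  exists 0 => j; rewrite mul0r; apply: (mulfI nz0).
  by rewrite (xE i0 j) x0 !mulr0.
have [_ /(_ (c`_i0 * g)) []] := gcdg (x i0) (elimT (@lregP A _) nzx).
  move=> _ /mapP[y ys ->]; have [m ->] := sp y ys.
  have [->|/cP[j <-]] := eqVneq p@_m 0; first by exists 0; rewrite !mul0r mulr0.
  exists (x j); rewrite mulrA [x i0 * _]mulrC -(xE i0 j).
  by rewrite -!mulrA mulrCA.
move=> y yE; exists y => j; apply: (mulfI nz0).
have x0E : x i0 = y * c`_i0 by apply: (mulIf nzg); rewrite yE mulrA.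
by rewrite (xE i0 j) x0E mulrCA mulrA mulrC mulrA.
Qed.

Lemma tofrac_S_div_neq0 f : S_div f -> tofrac f != 0.
Proof. by move=> Sf; rewrite tofrac_eq0 S_div_neq0. Qed.

Lemma tofrac_div_inj s f g :
  S_div s -> tofrac f / tofrac s = tofrac g / tofrac s -> f = g.
Proof.
move=> Ss /(divIf (tofrac_S_div_neq0 Ss)) /eqP.
by rewrite tofrac_eq => /eqP.
Qed.

Lemma div_nagata_valM (x y : B) : val (x * y) = val x * val y.
Proof. exact: rmorphM. Qed.

Lemma div_nagata_valD (x y : B) : val (x + y) = val x + val y.
Proof. exact: rmorphD. Qed.

Lemma div_nagata_val0 : val (0 : B) = 0.
Proof. exact: rmorph0. Qed.

Lemma div_nagata_val1 : val (1 : B) = 1.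
Proof. exact: rmorph1. Qed.

Lemma div_nagata_val_sum k (x : 'I_k -> B) :
  val (\sum_i x i) = \sum_i val (x i).
Proof. exact: rmorph_sum. Qed.

Lemma div_nagata_integral : integral_ring B.
Proof.
move=> x; have [->|nzx] := eqVneq x 0; [by left | right] => y z /(congr1 val).
rewrite !div_nagata_valM => /mulfI eqyz; apply/val_inj/eqyz.
by rewrite -div_nagata_val0 (inj_eq val_inj).
Qed.

Lemma in_div_nagata f g : S_div g -> exists x : B, val x = tofrac f / tofrac g.
Proof.
move=> Sg; have xP : tofrac f / tofrac g \in @div_nagata_pred A n.
  by apply/asboolP; exists f, g.
by exists (DivNagata xP).
Qed.

Lemma poly_in_div_nagata f : exists x : B, val x = tofrac f.
Proof.
by have [x] := in_div_nagata f (S_div1 A n); rewrite rmorph1 divr1; exists x.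
Qed.

Lemma S_div_prod (K : finType) (P : pred K) (s : K -> {mpoly A[n]}) :
  (forall k, S_div (s k)) -> S_div (\prod_(k | P k) s k).
Proof. by move=> Ss; apply: (big_ind _ (S_div1 A n) (@S_divM A n)). Qed.

Lemma div_nagata_common_denominator (K : finType) (x : K -> B) :
  exists (F : K -> {mpoly A[n]}) s,
    S_div s /\ forall k, val (x k) = tofrac (F k) / tofrac s.
Proof.
have xP k : exists fs : {mpoly A[n]} * {mpoly A[n]},
    S_div fs.2 /\ val (x k) = tofrac fs.1 / tofrac fs.2.
  by have /asboolP[f [s fs]] := valP (x k); exists (f, s).
have [fs /all_and2[Ss xE]] := fin_all_exists xP.
exists (fun k => (fs k).1 * \prod_(l | l != k) (fs l).2), (\prod_l (fs l).2).
split=> [|k]; first exact: S_div_prod.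
rewrite [\prod_l _](bigD1 k) //= !rmorphM /= -mulf_div divff ?mulr1 ?xE //.
exact/tofrac_S_div_neq0/S_div_prod.
Qed.

Lemma div_nagata_pair : (0 < n)%N -> ring_with_divisors A -> forall x y : B,
  exists z, divides (x + z * y) x /\ divides (x + z * y) y.
Proof.
move=> n_gt0 [_ divA] x y.
have [F [s [Ss FE]]] :=
  div_nagata_common_denominator (fun b => if b then x else y).
have [w [wl wr]] := mpoly_merge (F true) (F false) n_gt0.
set f := F true + _ in wl wr; have [z zE] := poly_in_div_nagata 'X_[w].
have nzs := tofrac_S_div_neq0 Ss.
have fE : val (x + z * y) = tofrac f / tofrac s.
  rewrite div_nagata_valD div_nagata_valM zE (FE true) (FE false) mulrA -mulrDl.
  by rewrite rmorphD rmorphM.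
have Ff b m : exists m', f@_m' = (F b)@_m by case: b.
exists z; suff dF b : divides (x + z * y) (if b then x else y).
  by split; [apply: (dF true) | apply: (dF false)].
(* If [f] is 0, so are both numerators, whose coefficients all occur in [f]. *)
have [f0|nzf] := eqVneq f 0.
  exists 0; rewrite mul0r; apply: val_inj; rewrite FE.
  suff -> : F b = 0 by rewrite div_nagata_val0 rmorph0 mul0r.
  by apply/mpolyP => m; have [m' <-] := Ff b m; rewrite f0 !mcoeff0.
have [||t [_ [g sgcd]]] := divA [seq f@_m | m <- msupp f].
- by move/eqP; rewrite -size_eq0 size_map size_eq0 msupp_eq0 (negbTE nzf).
- by move=> _ /mapP[m fm ->]; apply/lregP; rewrite -mcoeff_msupp.
have [/lregP nzg gcdg] := sgcd.
have gprod m v : v \in t -> divides g (f@_m * v).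
  move=> vt; have [fm|/memN_msupp_eq0 ->] := boolP (m \in msupp f); last first.
    by exists 0; rewrite !mul0r.
  have [+ _] := gcdg 1 (@lreg1 A); rewrite mul1r; apply.
  apply/mapP; exists (f@_m * v); rewrite ?mul1r //.
  by apply: allpairs_f => //; apply: (map_f (fun m => f@_m)).
have [h [fh th]] := mpoly_with_products f t n_gt0.
(* This is used for [q = f] and for [q = F b]: coefficients of [q] occur in [f], those of [h] lie in
   the ideal of [t]. *)
have gFh q m : (forall k, exists k', f@_k' = q@_k) -> divides g (q * h)@_m.
  move=> fq; case: (divides_is_ideal g) => g0 gD gM.
  rewrite mcoeffM; elim/big_rec: _ => // i a _; apply: (gD).
  have [k <-] := fq (val i.1); move: (th (val i.2)).
  apply: (gen_ideal_sub (I := fun a => divides g (f@_k * a))) => [|v vt].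
    split=> [|a1 a2|a1 a2]; rewrite ?mulr0 ?mulrDr; [exact: g0|exact: gD|].
    by rewrite mulrCA; apply: gM.
  exact: gprod.
have [p pE] : exists p, f * h = g *: p.
  by apply: mpoly_divides => m; apply: gFh => k; exists k.
have Sp : S_div p.
  apply: (S_div_strong_gcd sgcd) => _ /allpairsP[[a v] /= [/mapP[m _ ->] vt ->]].
  have [m' <-] := fh v m vt; exists m'.
  by rewrite pE mcoeffZ mulrC.
have [q qE] : exists q, F b * h = g *: q.
  by apply: mpoly_divides => m; apply: gFh; apply: Ff.
(* With [f h = g p] and [F b h = g q], the multiplier is [q / p]. It remains to see that
   [F b * p = q * f], which holds after multiplication by [h]. *)
have [c cE] := in_div_nagata q Sp; exists c; apply: val_inj.
rewrite div_nagata_valM cE fE FE mulrA; congr (_ / _).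
have nzp := tofrac_S_div_neq0 Sp; apply: (mulIf nzp).
rewrite mulrAC divfK // -!rmorphM /=; congr tofrac.
have nzh : h != 0.
  apply/eqP => h0; have /eqP := pE; rewrite h0 mulr0 -mul_mpolyC eq_sym.
  by rewrite mulf_eq0 mpolyC_eq0 (negbTE nzg) (negbTE (S_div_neq0 Sp)).
apply: (mulIf nzh); rewrite -[RHS]mulrA pE -scalerAr mulrAC qE.
by rewrite -scalerAl mulrC.
Qed.

Lemma ring_with_divisors_of_prufer : prufer_domain B -> ring_with_divisors A.
Proof.
case=> _ pruB; split; first exact: idomain_integral.
move=> s nzs regs.
have [phi phiE] := choice (fun a : A => poly_in_div_nagata a%:MP).
have s_gt0 : (0 < size s)%N by rewrite lt0n size_eq0; apply/eqP.
pose k0 : 'I_(size s) := Ordinal s_gt0.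
have reg i : (i < size s)%N -> s`_i != 0 by move=> lt; apply/lregP/regs/mem_nth.
have inv : invertible_ideal (gen_ideal (map phi s)).
  apply: pruB; exists (phi s`_0); first by apply/mem_gen_ideal/map_f/mem_nth.
  move/(congr1 val); rewrite phiE div_nagata_val0 => /eqP; rewrite tofrac_eq0 mpolyC_eq0.
  by rewrite (negbTE (reg _ s_gt0)).
have [e0 [tr0 e0E]] := invertible_localization_matrix inv.
have sz : size s = size (map phi s) by rewrite size_map.
pose e i j := e0 (cast_ord sz i) (cast_ord sz j).
have [E [u [Su EE]]] := div_nagata_common_denominator (fun ij => e ij.1 ij.2).
have nzu := tofrac_S_div_neq0 Su.
have trE : \sum_i E (i, i) = u.
  apply: (tofrac_div_inj Su).
  rewrite rmorph_sum mulr_suml divff //.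
  rewrite -div_nagata_val1 -tr0 div_nagata_val_sum.
  rewrite (reindex (cast_ord sz)) /=; last first.
    by exists (cast_ord (esym sz)) => i _; rewrite ?cast_ordK ?cast_ordKV.
  by apply: eq_bigr => i _; rewrite -(EE (i, i)).
have Em (i j k : 'I_(size s)) m : s`_k * (E (i, j))@_m = s`_i * (E (k, j))@_m.
  rewrite -!mcoeffZ; congr (_@__); apply: (tofrac_div_inj Su).
  rewrite -!mul_mpolyC !rmorphM /= -!mulrA -(EE (i, j)) -(EE (k, j)) -!phiE.
  rewrite -!div_nagata_valM; congr val.
  have := e0E (cast_ord sz i) (cast_ord sz j) (cast_ord sz k).
  by rewrite !(nth_map 0) /= ?ltn_ord //.
(* Only the nonzero coefficients of row [k0] are listed, since the entries of [t] must be
   regular. *)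
pose t := flatten [seq [seq (E (k0, j))@_m | m <- msupp (E (k0, j))]
                  | j <- enum 'I_(size s)].
have tP v : v \in t <-> exists j m, v = (E (k0, j))@_m /\ v != 0.
  split.
    case/flatten_mapP => j _ /mapP[m Em0 ->]; exists j, m.
    by rewrite -mcoeff_msupp.
  case=> j [m [-> nz]]; apply/flatten_mapP; exists j; first exact: mem_enum.
  by apply: map_f; rewrite mcoeff_msupp.
exists t; split; first by move=> v /tP[j [m [_ nz]]]; apply/lregP.
exists s`_0; split; first exact/lregP/reg.
move=> x /lregP nzx; split=> [_ /mapP[_ /allpairsP[[a v] /= [sa tv ->]] ->]|d dE].
  have [i lt_i <-] := nthP 0 sa; have [j [m [-> _]]] := (tP v).1 tv.
  exists (E (Ordinal lt_i, j))@_m; rewrite (Em k0 j (Ordinal lt_i)).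
  by rewrite [RHS]mulrC mulrA.
have dEm i j m : divides d (x * s`_0 * (E (i, j))@_m).
  rewrite -mulrA -(Em k0 j i m).
  have [->|nz] := eqVneq (E (k0, j))@_m 0.
    by exists 0; rewrite mul0r !mulr0.
  apply: dE; apply: map_f; apply: allpairs_f; first exact: mem_nth.
  by apply/tP; exists j, m.
(* Summing over the diagonal of [E] turns divisibility of the entries into divisibility for the
   denominator. *)
have du m : divides d (x * s`_0 * u@_m).
  rewrite -trE raddf_sum mulr_sumr.
  by apply: is_ideal_sum (divides_is_ideal d) _ => i; apply: dEm.
have nzd : d != 0.
  apply/eqP => d0; case/eqP: (S_div_neq0 Su); apply/mpolyP => m; rewrite mcoeff0.
  have [y /eqP] := du m; rewrite d0 mulr0 !mulf_eq0 (negbTE nzx).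
  by rewrite (negbTE (reg _ s_gt0)) => /eqP.
(* Depth at least 2 of the content of [u] removes the factors [u@_m]. *)
rewrite -[x * _]mulr1; apply: (S_div_saturated nzd Su) => m.
by rewrite mulr1.
Qed.

End Nagata.

Theorem mainTheorem9 (A : idomainType) (n : nat) (n_gt0 : (0 < n)%N) :
  (ring_with_divisors A <-> prufer_domain (div_nagata A n)) /\
  (ring_with_divisors A <-> bezout_domain (div_nagata A n)).
Proof.
(* Both equivalences come from one cycle: ring with divisors, Bézout, Prüfer, ring with divisors. *)
have bez : ring_with_divisors A -> bezout_domain (div_nagata A n).
  move=> divA; apply: bezout_domain_of_pair; first exact: div_nagata_integral.
  exact: div_nagata_pair.
split; split=> [/bez|] //; first exact: bezout_prufer.
- exact: ring_with_divisors_of_prufer.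
- by move/bezout_prufer; apply: ring_with_divisors_of_prufer.
Qed.
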